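(* Let $R$ be a rectangle and let $A_1,\dots,A_n>0$ satisfy $\sum_{i=1}^n A_i=\mathrm{Area}(R)$. Let $R_1,\dots,R_n$, with $\mathrm{Area}(R_i)=A_i$, be the partition of $R$ output by the algorithm ApproximationDC applied to $R$ and $L=\{A_1,\dots,A_n\}$. If for every $i\in\{1,\dots,n\}$ either $\mathrm{AR}(R_i)\le 3$ or $R_i$ is a forced rectangle, then the approximation factor is at most $2/\sqrt{3}<1.1548$; that is, $$\sum_{i=1}^n \mathrm{Perim}(R_i)\;\le\;\frac{2}{\sqrt{3}}\cdot \sum_{i=1}^n \mathrm{Perim}(S_i)$$ for every partition of $R$ into sub-rectangles $S_1,\dots,S_n$ with $\mathrm{Area}(S_i)=A_i$ for all $i$.
   Context: Rectangles are axis-parallel, and a partition of a rectangle $R$ into sub-rectangles is a collection of sub-rectangles with pairwise disjoint interiors whose union is $R$. For a rectangle $Q$, the perimeter is defined as $\mathrm{Perim}(Q)=\mathrm{width}(Q)+\mathrm{height}(Q)$, and the aspect ratio is $\mathrm{AR}(Q)=\max\{\mathrm{width}(Q)/\mathrm{height}(Q),\ \mathrm{height}(Q)/\mathrm{width}(Q)\}$. Algorithm ApproximationDC$(R,L)$. Input: a rectangle $R$ and a list $L$ of $n\ge 1$ positive areas with sum $\mathrm{Area}(R)$. Sort $L$ in non-increasing order, reindexing so that $A_1\ge A_2\ge\dots\ge A_n$, and call Partition$(R,L)$. Partition$(Q,\Lambda)$, where $\Lambda$ is a list of areas, sorted in non-increasing order, with sum $\mathrm{Area}(Q)$: (1) If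 $\Lambda$ has a single area, return $Q$ as the rectangle assigned to that area. (2) Otherwise regard each area of $\Lambda$ as a singleton block; the area of a block is the sum of the areas in it. Keep the list of blocks sorted by block area in non-increasing order. While there are more than two blocks, merge the two blocks of smallest area (the last two in the list) into one block (their union) and re-insert it so that the list stays sorted. When exactly two blocks $\Lambda_1,\Lambda_2$ remain, with areas $a_1\ge a_2$: if $\mathrm{width}(Q)>\mathrm{height}(Q)$, divide $Q$ by a vertical line into $Q_1$ (left, area $a_1$) and $Q_2$ (right, area $a_2$); otherwise divide $Q$ by a horizontal line into $Q_1$ (top, area $a_1$) and $Q_2$ (bottom, area $a_2$). Return Partition$(Q_1,\Lambda_1)\,\cup\,$Partition$(Q_2,\Lambda_2)$. When a call divides $Q$ into $Q_1$ and $Q_2$, these are called the left child and the right child of $Q$ respectively, regardless of their actual positioning. Forced rectangles: the original rectangle $R$ is a forced rectangle. The right child $R_2$ of $R$ is a forced rectangle if $A_1\ge \mathrm{Area}(R)/2$, where $A_1$ is the largest area in the list. Any rectangle whose long edges are both contained in the long edges of a forced rectangle is a forced rectangle. *)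

(* Defs.v *)
From HB Require Import structures.
From mathcomp Require Import all_boot all_order all_algebra.
From mathcomp Require Import classical_sets reals topology normedtype.

Set Implicit Arguments.
Unset Strict Implicit.
Unset Printing Implicit Defensive.

Import Order.TTheory GRing.Theory Num.Theory.
Import numFieldNormedType.Exports.

Local Open Scope ring_scope.
Local Open Scope classical_set_scope.

(* The axis-parallel rectangle [x0, x1] x [y0, y1]. *)
Record rect (R : realType) := Rect {
  x0 : R; x1 : R; y0 : R; y1 : R;
  x0_lt_x1 : x0 < x1;
  y0_lt_y1 : y0 < y1
}.

Section Rectangles.
Variable R : realType.
Implicit Types Q F : rect R.

Definition width Q : R := x1 Q - x0 Q.
Definition height Q : R := y1 Q - y0 Q.
Definition area Q : R := width Q * height Q.

(* Half of the usual perimeter. *)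
Definition perim Q : R := width Q + height Q.

Definition aspect_ratio Q : R :=
  Num.max (width Q / height Q) (height Q / width Q).

Definition points Q : set (R * R) :=
  [set p | x0 Q <= p.1 <= x1 Q /\ y0 Q <= p.2 <= y1 Q].

Definition is_partition (n : nat) Q (S : 'I_n -> rect R) : Prop :=
  \bigcup_(i in [set: 'I_n]) points (S i) = points Q /\
  trivIset [set: 'I_n] (fun i => interior (points (S i))).

Definition bottom_edge Q : set (R * R) := [set p | points Q p /\ p.2 = y0 Q].
Definition top_edge Q : set (R * R) := [set p | points Q p /\ p.2 = y1 Q].
Definition left_edge Q : set (R * R) := [set p | points Q p /\ p.1 = x0 Q].
Definition right_edge Q : set (R * R) := [set p | points Q p /\ p.1 = x1 Q].

(* [long_edges Q E]: E is the union of the two long edges of Q.  In a square,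
   either pair of opposite edges may be taken as the long ones. *)
Definition long_edges Q (E : set (R * R)) : Prop :=
  (height Q <= width Q /\ E = bottom_edge Q `|` top_edge Q) \/
  (width Q <= height Q /\ E = left_edge Q `|` right_edge Q).

Definition long_edges_in Q F : Prop :=
  exists E E', [/\ long_edges Q E, long_edges F E' & E `<=` E'].

Definition divides_vertically Q (a1 a2 : R) (Q1 Q2 : rect R) : Prop :=
  [/\ area Q1 = a1 /\ area Q2 = a2,
      x0 Q1 = x0 Q, x1 Q1 = x0 Q2, x1 Q2 = x1 Q &
      [/\ y0 Q1 = y0 Q, y1 Q1 = y1 Q, y0 Q2 = y0 Q & y1 Q2 = y1 Q]].

Definition divides_horizontally Q (a1 a2 : R) (Q1 Q2 : rect R) : Prop :=
  [/\ area Q1 = a1 /\ area Q2 = a2,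
      y1 Q1 = y1 Q, y0 Q1 = y1 Q2, y0 Q2 = y0 Q &
      [/\ x0 Q1 = x0 Q, x1 Q1 = x1 Q, x0 Q2 = x0 Q & x1 Q2 = x1 Q]].

Definition divides Q (a1 a2 : R) (Q1 Q2 : rect R) : Prop :=
  if height Q < width Q then divides_vertically Q a1 a2 Q1 Q2
  else divides_horizontally Q a1 a2 Q1 Q2.

End Rectangles.

(* The tree of recursive calls: [Leaf Q i] is a call on Q that returns Q as the
   rectangle of the i-th area, and [Node Q l r] a call that divides Q into the
   left child [root l] and the right child [root r]. *)
Inductive call_tree (R : realType) (n : nat) : Type :=
| Leaf of rect R & 'I_n
| Node of rect R & call_tree R n & call_tree R n.

Section Algorithm.
Variables (R : realType) (n : nat).

(* Areas are handled through their indices, so that equal areas remain distinct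
   items of a list; a block is the list of the indices of its areas. *)
Variable A : 'I_n -> R.

Definition block_area (B : seq 'I_n) : R := \sum_(i <- B) A i.

Definition areas_sorted (L : seq 'I_n) : bool :=
  sorted (fun i j => A j <= A i) L.

Definition blocks_sorted (Bs : seq (seq 'I_n)) : bool :=
  sorted (fun B C => block_area C <= block_area B) Bs.

(* [merge_loop Bs B1 B2]: the merging loop, started on the list of blocks Bs,
   can end with the list [:: B1; B2].  Here and in [partition_call] ties between
   equal areas may be broken in any way, hence relations, not functions. *)
Inductive merge_loop : seq (seq 'I_n) -> seq 'I_n -> seq 'I_n -> Prop :=
| merge_done B1 B2 : merge_loop [:: B1; B2] B1 B2
| merge_step s1 s2 B C B1 B2 :
    (0 < size (s1 ++ s2))%N ->
    blocks_sorted (s1 ++ (B ++ C) :: s2) ->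
    merge_loop (s1 ++ (B ++ C) :: s2) B1 B2 ->
    merge_loop ((s1 ++ s2) ++ [:: B; C]) B1 B2.

Inductive partition_call : rect R -> seq 'I_n -> call_tree R n -> Prop :=
| call_leaf Q i : partition_call Q [:: i] (Leaf Q i)
| call_node Q L B1 B2 L1 L2 Q1 Q2 t1 t2 :
    merge_loop [seq [:: i] | i <- L] B1 B2 ->
    perm_eq L1 B1 -> areas_sorted L1 ->
    perm_eq L2 B2 -> areas_sorted L2 ->
    divides Q (block_area B1) (block_area B2) Q1 Q2 ->
    partition_call Q1 L1 t1 ->
    partition_call Q2 L2 t2 ->
    partition_call Q L (Node Q t1 t2).

Definition ApproximationDC (Q : rect R) (t : call_tree R n) : Prop :=
  exists L, [/\ perm_eq L (enum 'I_n), areas_sorted L & partition_call Q L t].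

Definition root (t : call_tree R n) : rect R :=
  match t with Leaf Q _ => Q | Node Q _ _ => Q end.

(* The rectangle P is the one returned for the i-th area. *)
Fixpoint assigned (t : call_tree R n) (i : 'I_n) (P : rect R) : Prop :=
  match t with
  | Leaf Q j => i = j /\ P = Q
  | Node _ l r => assigned l i P \/ assigned r i P
  end.

Inductive forced : call_tree R n -> rect R -> Prop :=
| forced_root t : forced t (root t)
| forced_right Q l r i :
    (forall j, A j <= A i) -> area Q / 2 <= A i ->
    forced (Node Q l r) (root r)
| forced_long t F P :
    forced t F -> long_edges_in P F -> forced t P.

End Algorithm.

(* Main.v *)
Require Import Defs.
From mathcomp Require Import all_boot all_order all_algebra.
From mathcomp Require Import classical_sets reals topology normedtype.
From mathcomp Require Import ring lra.

(** The inequality holds rectangle by rectangle.  Write A = Area(P_i).  If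
    AR(P_i) <= 3 then Perim(P_i) <= (2 / sqrt 3) * 2 sqrt A, and 2 sqrt A is at
    most Perim(S_i).  If P_i is forced, its short side s is the short side of
    R or of the right child R_2.  Among rectangles of area A = Area(P_i) >= s^2
    with a side of length at most s, P_i has the least perimeter, so it
    suffices that S_i has such a side.  For R this is S_i being inside R.  For
    R_2, the Huffman merging never merges an area A_1 >= Area(R) / 2, so that
    Area(R_2) = Area(R) - A_1; as the interiors of S_i and S_1 are disjoint,
    S_i is squeezed between S_1 and a side of R, hence no wider (or no higher)
    than R_2.  The case of P_1 = R_2 is special: it is the bisection of R, and
    there either R_2 has the same short side as R or its aspect ratio is at
    most 2. *)

Set Implicit Arguments.
Unset Strict Implicit.
Unset Printing Implicit Defensive.

Import Order.TTheory GRing.Theory Num.Theory.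
Import numFieldNormedType.Exports.

Local Open Scope ring_scope.

(** * Inequalities between side lengths *)

Section Sides.
Variable R : realFieldType.
Implicit Types w h u v p q b : R.

(** Since [w * h = u * v], the product [u * (u + v - (w + h))] equals [(w - u) * (h - u)], whose
    factors are both nonnegative; the case of [v] is symmetric. *)
Lemma le_perim_of_short_side w h u v :
  0 < u -> 0 < v -> w * h = u * v ->
  u <= Num.min w h \/ v <= Num.min w h -> w + h <= u + v.
Proof.
move=> u0 v0 e; rewrite !le_min.
case=> /andP[h1 h2].
- have : 0 <= u * (u + v - (w + h)) by nra.
  by rewrite pmulr_rge0 // subr_ge0.
- have : 0 <= v * (u + v - (w + h)) by nra.
  by rewrite pmulr_rge0 // subr_ge0.
Qed.

(* (u, v) and (p, q) are the sides of two non-overlapping rectangles inside a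
   W x H rectangle, from which a b x H rectangle of area W H - p q is cut. *)
Lemma squeezed_side (W H b u v p q : R) :
  0 < H -> H <= W -> 0 < p <= W -> 0 < q <= H -> v <= H ->
  b * H = W * H - p * q -> u + p <= W \/ v + q <= H ->
  u <= Num.min b H \/ v <= Num.min b H.
Proof.
move=> H0 HW /andP[p0 pW] /andP[q0 qH] vH e sep; rewrite !le_min vH andbT.
have [Hb|bH] := leP H b; first by right; apply: le_trans vH Hb.
have W0 : 0 < W by lra.
case: sep => sep; [left|right].
- rewrite (ltW (le_lt_trans _ bH)) ?andbT.
  + by rewrite -(ler_pM2r H0); nra.
  + by rewrite -(ler_pM2r H0); nra.
(* Here [b * W >= b * H >= W * (H - q) >= W * v]; the first inequality requires [b >= 0]. *)
- have b0 : 0 <= b by rewrite -(pmulr_lge0 _ H0); nra.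
  by rewrite -(ler_pM2r W0); nra.
Qed.

(** A [w] x [h] rectangle fits in the cut-off [b] x [H] piece but has the area of the complementary
    piece, at least half of the whole. This forces [w = b = W / 2] and [h = H], and then
    [b < H <= W] keeps both side ratios at most 2. *)
Lemma bisection_sides (W H b w h : R) :
  0 < H -> H <= W -> 0 < w -> 0 < h ->
  w <= b -> h <= H -> w * h = W * H - b * H -> W * H / 2 <= w * h ->
  b < H -> w <= 3 * h /\ h <= 3 * w.
Proof.
move=> H0 HW w0 h0 wb hH e half bH.
have bW : b <= W / 2 by rewrite -(ler_pM2r H0); nra.
have hH' : H <= h by rewrite -(ler_pM2l (lt_le_trans w0 wb)); nra.
have wW : W / 2 <= w by rewrite -(ler_pM2r H0); nra.
by split; lra.
Qed.

End Sides.

(** * The constant 2 / sqrt 3 *)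

Section Ratio.
Variable R : realType.

Lemma two_div_sqrt3_bounds : (1 : R) <= 2 / Num.sqrt (3 : R) < 11548 / 10000.
Proof.
have s0 : 0 < Num.sqrt (3 : R) by rewrite sqrtr_gt0.
have e : Num.sqrt (3 : R) * Num.sqrt 3 = 3 by rewrite -expr2 sqr_sqrtr.
by rewrite ler_pdivlMr // ltr_pdivrMr //; apply/andP; split; nra.
Qed.

(** After squaring, [(3 * h - w) * (3 * w - h) >= 0] says [3 * (w + h) ^+ 2 <= 16 * (w * h)], and
    [16 * (u * v) <= 4 * (u + v) ^+ 2]. Equality in the former at ratio 3 explains the constant. *)
Lemma le_perim_of_ratio3 (w h u v : R) :
  0 < w -> 0 < h -> 0 < u -> 0 < v -> w * h = u * v ->
  w <= 3 * h -> h <= 3 * w -> w + h <= 2 / Num.sqrt 3 * (u + v).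
Proof.
move=> w0 h0 u0 v0 e wh hw.
have s0 : 0 < Num.sqrt (3 : R) by rewrite sqrtr_gt0.
rewrite mulrAC ler_pdivlMr //.
rewrite -(@ler_pXn2r _ 2) ?nnegrE; [|by []|nra|nra].
rewrite exprMn sqr_sqrtr //.
have : 0 <= (3 * h - w) * (3 * w - h) by apply: mulr_ge0; lra.
have : 0 <= (u - v) ^+ 2 by apply: sqr_ge0.
by nra.
Qed.

End Ratio.

(** * Containment, disjointness and long edges of rectangles *)

Section Rectangles.
Variable R : realType.
Implicit Types Q F P S T : rect R.

Definition short_side Q : R := Num.min (width Q) (height Q).

Lemma width_gt0 Q : 0 < width Q.
Proof. by rewrite subr_gt0 x0_lt_x1. Qed.

Lemma height_gt0 Q : 0 < height Q.
Proof. by rewrite subr_gt0 y0_lt_y1. Qed.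

Lemma aspect_ratio_le Q (c : R) :
  aspect_ratio Q <= c -> width Q <= c * height Q /\ height Q <= c * width Q.
Proof.
by rewrite /aspect_ratio ge_max !ler_pdivrMr ?width_gt0 ?height_gt0 // => /andP.
Qed.

Definition inside P F : Prop :=
  (x0 F <= x0 P /\ x1 P <= x1 F) /\ (y0 F <= y0 P /\ y1 P <= y1 F).

Lemma inside_sides P F : inside P F -> width P <= width F /\ height P <= height F.
Proof. by case=> -[? ?] [? ?]; rewrite /width /height; split; lra. Qed.

Lemma inside_of_points P F : (points P `<=` points F)%classic -> inside P F.
Proof.
move=> sub; have hx := ltW (x0_lt_x1 P); have hy := ltW (y0_lt_y1 P).
have /sub[/= /andP[a _] /andP[b _]] : points P (x0 P, y0 P).
  by split=> /=; rewrite lexx.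
have /sub[/= /andP[_ c] /andP[_ d]] : points P (x1 P, y1 P).
  by split=> /=; rewrite lexx andbT.
by [].
Qed.

Lemma interior_points Q (z : R * R) :
  x0 Q < z.1 < x1 Q -> y0 Q < z.2 < y1 Q -> interior (points Q) z.
Proof.
case: z => a b /= ha hb.
exists (`]x0 Q, x1 Q[%classic, `]y0 Q, y1 Q[%classic).
  by split; apply: near_in_itvoo; rewrite in_itv.
case=> c d /= [] /=; rewrite !in_itv /= => /andP[? ?] /andP[? ?].
by split; rewrite /= !ltW.
Qed.

(** Otherwise both coordinate projections overlap, and the midpoints of the two overlaps give a
    common interior point. *)
Lemma separated_of_disjoint S T :
  (interior (points S) `&` interior (points T))%classic = set0 ->
  (x1 S <= x0 T \/ x1 T <= x0 S) \/ (y1 S <= y0 T \/ y1 T <= y0 S).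
Proof.
move=> dis.
have [|h1] := leP (x1 S) (x0 T); first by left; left.
have [|h2] := leP (x1 T) (x0 S); first by left; right.
have [|h3] := leP (y1 S) (y0 T); first by right; left.
have [|h4] := leP (y1 T) (y0 S); first by right; right.
exfalso.
have mid (a b c d : R) : a < b -> c < d -> c < b -> a < d ->
    exists z, a < z < b /\ c < z < d.
  move=> ab cd cb ad; exists ((Num.max a c + Num.min b d) / 2).
  by case: (leP a c) => ?; case: (leP b d) => ?; split; apply/andP; split; lra.
have [x [xS xT]] := mid _ _ _ _ (x0_lt_x1 S) (x0_lt_x1 T) h1 h2.
have [y [yS yT]] := mid _ _ _ _ (y0_lt_y1 S) (y0_lt_y1 T) h3 h4.
have : (interior (points S) `&` interior (points T))%classic (x, y).
  by split; apply: interior_points.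
by rewrite dis.
Qed.

Lemma partition_inside n Q (S : 'I_n -> rect R) i :
  is_partition Q S -> inside (S i) Q.
Proof.
case=> cover _; apply: inside_of_points; rewrite -cover.
by move=> z Sz; exists i.
Qed.

Lemma partition_separated n Q (S : 'I_n -> rect R) i j :
  is_partition Q S -> i != j ->
  width (S i) + width (S j) <= width Q \/
  height (S i) + height (S j) <= height Q.
Proof.
move=> part ij.
have [[a1 a2] [a3 a4]] := partition_inside i part.
have [[b1 b2] [b3 b4]] := partition_inside j part.
have /separated_of_disjoint : (interior (points (S i)) `&` interior (points (S j)))%classic = set0.
  case: part => _ /trivIsetP triv; exact: triv.
have := x0_lt_x1 (S i); have := x0_lt_x1 (S j).
have := y0_lt_y1 (S i); have := y0_lt_y1 (S j).
rewrite /width /height => ? ? ? ?.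
by case=> -[?|?]; [left|left|right|right]; lra.
Qed.

(** Parallel long edges of [P] lie on the two lines carrying those of [F], one on each, so the
    distance between them is the same. *)
Lemma long_edges_in_short_side P F : long_edges_in P F ->
  [/\ short_side P = short_side F, width P <= width F & height P <= height F].
Proof.
have hPx := x0_lt_x1 P; have hPy := y0_lt_y1 P.
have hFx := x0_lt_x1 F; have hFy := y0_lt_y1 F.
have midx : x0 P <= (x0 P + x1 P) / 2 <= x1 P by apply/andP; split; lra.
have midy : y0 P <= (y0 P + y1 P) / 2 <= y1 P by apply/andP; split; lra.
have lx : x0 P <= x0 P <= x1 P by rewrite lexx ltW.
have rx : x0 P <= x1 P <= x1 P by rewrite lexx ltW.
have ly : y0 P <= y0 P <= y1 P by rewrite lexx ltW.
have ry : y0 P <= y1 P <= y1 P by rewrite lexx ltW.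
case=> E [E'] [[[le1 ->]|[le1 ->]] [[le2 ->]|[le2 ->]] sub].
- have a x (hx : x0 P <= x <= x1 P) := sub (x, y0 P) (or_introl (conj (conj hx ly) erefl)).
  have b x (hx : x0 P <= x <= x1 P) := sub (x, y1 P) (or_intror (conj (conj hx ry) erefl)).
  move: (a _ lx) (a _ rx) (b _ lx).
  rewrite /short_side /height /width in le1 le2 *.
  rewrite /bottom_edge /top_edge /points /=.
  case=> -[[/= /andP[? ?] _] /= e1]; case=> -[[/= /andP[? ?] _] /= e2];
  case=> -[[/= /andP[? ?] _] /= e3]; try lra;
  by rewrite !min_r //; split; lra.
- have a x (hx : x0 P <= x <= x1 P) := sub (x, y0 P) (or_introl (conj (conj hx ly) erefl)).
  (* Perpendicular long edges are impossible: the ends and the midpoint of an edge have three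
     distinct abscissae, but only [x0 F] and [x1 F] are available. *)
  move: (a _ lx) (a _ midx) (a _ rx); rewrite /left_edge /right_edge /=.
  by case=> -[_ /= e1]; case=> -[_ /= e2]; case=> -[_ /= e3]; lra.
- have a y (hy : y0 P <= y <= y1 P) := sub (x0 P, y) (or_introl (conj (conj lx hy) erefl)).
  move: (a _ ly) (a _ midy) (a _ ry); rewrite /bottom_edge /top_edge /=.
  by case=> -[_ /= e1]; case=> -[_ /= e2]; case=> -[_ /= e3]; lra.
- have a y (hy : y0 P <= y <= y1 P) := sub (x0 P, y) (or_introl (conj (conj lx hy) erefl)).
  have b y (hy : y0 P <= y <= y1 P) := sub (x1 P, y) (or_intror (conj (conj rx hy) erefl)).
  move: (a _ ly) (a _ ry) (b _ ly).
  rewrite /short_side /height /width in le1 le2 *.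
  rewrite /left_edge /right_edge /points /=.
  case=> -[[_ /= /andP[? ?]] /= e1]; case=> -[[_ /= /andP[? ?]] /= e2];
  case=> -[[_ /= /andP[? ?]] /= e3]; try lra;
  by rewrite !min_l //; split; lra.
Qed.

Lemma divides_sides Q (a1 a2 : R) Q1 Q2 : divides Q a1 a2 Q1 Q2 ->
  area Q2 = a2 /\
  ((height Q <= width Q /\ height Q2 = height Q) \/
   (width Q <= height Q /\ width Q2 = width Q)).
Proof.
rewrite /divides; case: ltP => [/ltW le|le].
- case=> -[_ e] _ _ _ [_ _ e0 e1]; split=> //; left.
  by rewrite /height e0 e1.
- case=> -[_ e] _ _ _ [_ _ e0 e1]; split=> //; right.
  by rewrite /width e0 e1.
Qed.

End Rectangles.

(** * The merging loop, forced rectangles and the bound for each area *)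

Section Algorithm.
Variables (R : realType) (n : nat) (A : 'I_n -> R).

Lemma block_area_cat B C : block_area A (B ++ C) = block_area A B + block_area A C.
Proof. exact: big_cat. Qed.

Lemma block_area_seq1 i : block_area A [:: i] = A i.
Proof. exact: big_seq1. Qed.

Lemma perm_block_area B C : perm_eq B C -> block_area A B = block_area A C.
Proof. exact: perm_big. Qed.

(* A block holding at least half of the total area is larger than any other of
   at least three blocks, so it is never among the two that are merged. *)
Lemma merge_loop_majority Bs B1 B2 m :
  merge_loop A Bs B1 B2 -> blocks_sorted A Bs ->
  all (fun B => 0 < block_area A B) Bs -> [:: m] \in Bs ->
  (\sum_(B <- Bs) block_area A B) / 2 <= A m ->
  block_area A B2 = \sum_(B <- Bs) block_area A B - A m.
Proof.
elim=> [{}B1 {}B2|s1 s2 B C {}B1 {}B2 s_gt0 new_sorted _ IH].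
  rewrite big_cons big_seq1 /blocks_sorted /= andbT => le21 _ m_in.
  (* If [[:: m]] is the smaller block [B2], both blocks have exactly half of the total, so the
     formula still holds. *)
  by move: m_in le21; rewrite !inE => /orP[] /eqP <-; rewrite block_area_seq1; lra.
move=> srt pos m_in half.
have sumE : \sum_(D <- (s1 ++ s2) ++ [:: B; C]) block_area A D =
    \sum_(D <- s1 ++ (B ++ C) :: s2) block_area A D.
  by rewrite !big_cat !big_cons big_nil block_area_cat /=; ring.
rewrite sumE; apply: IH => //; last by rewrite -sumE.
  move: pos; rewrite !all_cat /= block_area_cat.
  by case/andP=> /andP[-> ->] /and3P[B0 C0 _]; rewrite addr_gt0.
move: m_in; rewrite mem_cat => /orP[|m_BC].
  by rewrite !mem_cat inE => /orP[] ->; rewrite ?orbT.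
exfalso.
have trans : transitive (fun B C => block_area A C <= block_area A B).
  by move=> ? ? ? h1 h2; exact: le_trans h2 h1.
(* If [[:: m]] were merged, the leading block [D] would have area at least [A m]; with the other
   merged block, which is positive, the total would exceed [2 * A m]. *)
case: (s1 ++ s2) s_gt0 srt pos half => [//|D s] _ /= srt /andP[D0].
rewrite all_cat => /andP[pos_s /and3P[B0 C0 _]].
move: srt; rewrite (path_sortedE trans) all_cat /= andbT.
case/andP=> /andP[_ /andP[DB DC]] _.
rewrite big_cons big_cat !big_cons big_nil /=.
have : 0 <= \sum_(i <- s) block_area A i.
  rewrite big_seq; apply: sumr_ge0 => E Es; apply/ltW.
  exact: (allP pos_s).
move: m_BC DB DC B0 C0; rewrite !inE => /orP[] /eqP <-; rewrite block_area_seq1; lra.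
Qed.

Lemma partition_call_root Q L t : partition_call A Q L t -> Defs.root t = Q.
Proof. by case. Qed.

Lemma assigned_area Q L t i P :
  partition_call A Q L t -> area Q = block_area A L -> assigned t i P ->
  area P = A i.
Proof.
elim=> [{}Q j|{}Q {}L B1 B2 L1 L2 Q1 Q2 t1 t2 _ p1 _ p2 _ div _ IH1 _ IH2] /=.
  by rewrite block_area_seq1 => e [-> ->].
move=> _; have [e1 e2] : area Q1 = block_area A B1 /\ area Q2 = block_area A B2.
  by move: div; rewrite /divides; case: ifP => _ [[]].
case; [apply: IH1; rewrite e1|apply: IH2; rewrite e2];
  by apply: perm_block_area; rewrite perm_sym.
Qed.

(** Each long-edge containment preserves the short side and enlarges neither dimension, so a chain
    of them can be traced back to the rectangle it starts from. *)
Lemma forced_short_side t P : forced A t P ->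
  exists F, [/\ F = Defs.root t \/
      exists Q l r i, [/\ t = Node Q l r, F = Defs.root r & area Q / 2 <= A i],
    short_side P = short_side F, width P <= width F & height P <= height F].
Proof.
elim=> [{}t|Q l r i _ half|{}t F {}P _ [G [base e w h]] /long_edges_in_short_side[e' w' h']].
- by exists (Defs.root t); split=> //; left.
- by exists (Defs.root r); split=> //; right; exists Q, l, r, i.
- by exists G; split; rewrite ?e' //; [apply: le_trans w' w|apply: le_trans h' h].
Qed.

Hypothesis A_gt0 : forall i, 0 < A i.

(** The majority area remains a singleton block until the cut, and the cut keeps a shorter side of
    [Q] whole. This supplies the area equation of [squeezed_side] and [bisection_sides]. *)
Lemma right_child_sides Q L l r m :
  perm_eq L (enum 'I_n) -> areas_sorted A L -> \sum_(i < n) A i = area Q ->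
  partition_call A Q L (Node Q l r) -> area Q / 2 <= A m ->
  area (Defs.root r) = area Q - A m /\
  ((height Q <= width Q /\ height (Defs.root r) = height Q) \/
   (width Q <= height Q /\ width (Defs.root r) = width Q)).
Proof.
move=> permL srt sumA call half.
inversion call as [|? ? B1 B2 ? ? ? Q2 ? ? merge ? ? ? ? div ? call2]; subst.
have [e sides] := divides_sides div.
rewrite (partition_call_root call2).
have total : \sum_(B <- [seq [:: i] | i <- L]) block_area A B = area Q.
  rewrite big_map -sumA (perm_big _ permL) big_enum.
  by apply: eq_bigr => i _; exact: block_area_seq1.
split=> //; rewrite e -total; apply: merge_loop_majority merge _ _ _ _.
- rewrite /blocks_sorted sorted_map; apply: sub_sorted srt => i j.
  by rewrite /= !block_area_seq1.
- by rewrite all_map; apply/allP => i _ /=; rewrite block_area_seq1.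
- by apply/mapP; exists m; rewrite // (perm_mem permL) mem_enum.
- by rewrite total.
Qed.

Lemma assigned_perim_le Q t i P (S : 'I_n -> rect R) :
  \sum_(i < n) A i = area Q -> ApproximationDC A Q t -> assigned t i P ->
  aspect_ratio P <= 3 \/ forced A t P ->
  is_partition Q S -> (forall i, area (S i) = A i) ->
  perim P <= 2 / Num.sqrt 3 * perim (S i).
Proof.
move=> sumA [L [permL srt call]] asg hyp part areaS.
have areaP : area P = A i.
  apply: assigned_area call _ asg.
  by rewrite (perm_block_area permL) /block_area big_enum sumA.
have areaPS : width P * height P = width (S i) * height (S i).
  by rewrite -/(area _) areaP -/(area _) areaS.
have [wP hP wS hS] := And4 (width_gt0 P) (height_gt0 P) (width_gt0 (S i)) (height_gt0 (S i)).
have ratio3 : width P <= 3 * height P -> height P <= 3 * width P ->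
    perim P <= 2 / Num.sqrt 3 * perim (S i).
  exact: le_perim_of_ratio3.
have short : width (S i) <= short_side P \/ height (S i) <= short_side P ->
    perim P <= 2 / Num.sqrt 3 * perim (S i).
  move=> le_short; apply: (@le_trans _ _ (perim (S i))).
    exact: le_perim_of_short_side.
  case/andP: (two_div_sqrt3_bounds R) => c_ge1 _; apply: ler_peMl c_ge1.
  by rewrite addr_ge0 // ltW.
have inQ j := inside_sides (partition_inside j part).
have [wSQ hSQ] := inQ i.
case: hyp => [/aspect_ratio_le[]|/forced_short_side[F [base eF wF hF]]]; first exact: ratio3.
case: base => [eq_root|[Q' [l [r [m [et eq_r]]]]]].
  apply: short; rewrite eF eq_root (partition_call_root call) /short_side.
  by case: (leP (width Q) (height Q)) => _; [left|right].
rewrite et in call => half.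
have eQ : Q' = Q by have := partition_call_root call.
rewrite eQ in call half.
have [W0 H0] := (width_gt0 Q, height_gt0 Q).
have [] := right_child_sides permL srt sumA call half.
rewrite -eq_r => areaF sides.
(* For [i = m] there is no second rectangle to squeeze against. Either the short side of [F] is that
   of [Q], which bounds a side of [S i], or [bisection_sides] applies to [P] and [F]. *)
have [eim|im] := eqVneq i m.
  rewrite -eim in areaF half.
  case: sides => -[le e].
  + have [HF|FH] := leP (height Q) (width F).
      by apply: short; right; rewrite eF /short_side e le_min hSQ (le_trans hSQ HF).
    rewrite e in hF.
    have bF : width F * height Q = width Q * height Q - A i by rewrite -[in LHS]e.
    have [||] := bisection_sides H0 le wP hP wF hF _ _ FH; last exact: ratio3.
    * by rewrite -/(area P) areaP bF; ring.
    * by rewrite -/(area P) areaP.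
  + have [HF|FH] := leP (width Q) (height F).
      by apply: short; left; rewrite eF /short_side e le_min wSQ (le_trans wSQ HF).
    rewrite e in wF.
    have bF : height F * width Q = height Q * width Q - A i.
      by rewrite -[in LHS]e [LHS]mulrC [X in X - _]mulrC.
    have [||? ?] := bisection_sides W0 le hP wP hF wF _ _ FH; last exact: ratio3.
    * by rewrite [LHS]mulrC -/(area P) areaP bF; ring.
    * by rewrite [X in X / 2]mulrC [leRHS]mulrC -/(area P) areaP.
have [wmQ hmQ] := inQ m.
have sep := partition_separated part im.
have [p0 q0] := (width_gt0 (S m), height_gt0 (S m)).
apply: short; rewrite eF /short_side.
case: sides => -[le e]; rewrite e.
- apply: (@squeezed_side R (width Q) _ _ _ _ (width (S m)) (height (S m))) => //.
  + by rewrite p0.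
  + by rewrite q0.
  + by rewrite -[in LHS]e -!/(area _) areaS.
(* The same argument with the two axes exchanged. *)
- rewrite minC; apply/or_comm.
  apply: (@squeezed_side R (height Q) _ _ _ _ (height (S m)) (width (S m))) => //.
  + by rewrite q0.
  + by rewrite p0.
  + by rewrite -[in LHS]e ![_ * width _]mulrC -!/(area _) areaS.
  + by case: sep; [right|left].
Qed.

End Algorithm.

Theorem mainTheorem2 (R : realType) (n : nat) (Q : rect R) (A : 'I_n -> R)
    (t : call_tree R n) (P : 'I_n -> rect R) :
  (0 < n)%N ->
  (forall i, 0 < A i) ->
  \sum_(i < n) A i = area Q ->
  ApproximationDC A Q t ->
  (forall i, assigned t i (P i)) ->
  (forall i, aspect_ratio (P i) <= 3 \/ forced A t (P i)) ->
  (forall S : 'I_n -> rect R,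
      is_partition Q S ->
      (forall i, area (S i) = A i) ->
      \sum_(i < n) perim (P i)
        <= 2 / Num.sqrt 3 * \sum_(i < n) perim (S i))
  /\ 2 / Num.sqrt 3 < 11548 / 10000 :> R.
Proof.
move=> _ A_gt0 sumA run asg hyp; split; last by case/andP: (two_div_sqrt3_bounds R).
move=> S part areaS; rewrite mulr_sumr; apply: ler_sum => i _.
exact: assigned_perim_le sumA run (asg i) (hyp i) part areaS.
Qed.
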